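(* Let $n\ge 1$ be an integer and let $X$ be an $S(n)$-space. Then $X$ is a minimal $S(n)$-space if and only if $X$ is $S(n)$-closed and the following holds: for every infinite set $A\subseteq X$ and every point $x\in X$, if $A$ does not $\theta(n)$-converge to $X\setminus\{x\}$, then $x$ is a complete accumulation point of $A$.
   Context: All neighborhoods are open; $\overline{M}=\mathrm{cl}\,M$ is the closure in the space $X$. $\theta^n$-closure: $\mathrm{cl}_{\theta^0}M=\mathrm{cl}\,M$; for $n\ge 1$, $x\notin \mathrm{cl}_{\theta^n}M$ iff there are open neighborhoods $U_1,\dots,U_n$ of $x$ with $\mathrm{cl}\,U_i\subseteq U_{i+1}$ for $i=1,\dots,n-1$ and $\mathrm{cl}\,U_n\cap M=\emptyset$. The $\theta^n$-interior is $\mathrm{Int}_{\theta^n}M=X\setminus \mathrm{cl}_{\theta^n}(X\setminus M)$. For $n\ge1$, $X$ is an $S(n)$-space if $x\notin\mathrm{cl}_{\theta^n}\{y\}$ for any two distinct points $x,y\in X$. An $S(n)$-space is $S(n)$-closed if it is closed in every $S(n)$-space containing it as a subspace. An $S(n)$-space is minimal $S(n)$ if its underlying set carries no strictly coarser $S(n)$ topology. A point $x$ is a complete accumulation point of an infinite set $F$ if $|F\cap U|=|F|$ for every neighborhood $U$ of $x$. For $k\ge 0$, an $S(k)$-cover of a subset $B\subseteq X$ is a family $\{U_\alpha\}$ of open subsets of $X$ such that $B\subseteq\bigcup_\alpha \mathrm{Int}_{\theta^k}U_\alpha$. A set $A$ $\theta(n)$-converges to a set $B$ if for every $S(n-1)$-cover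 $\gamma$ of $B$ there is a finite family $\{U_{\alpha_i}\}_{i=1}^k\subseteq\gamma$ such that $|A\setminus \bigcup_{i=1}^k\overline{U_{\alpha_i}}|<|A|$. *)

(* Defs.v *)
From HB Require Import structures.
From mathcomp Require Import all_boot all_order.
From mathcomp Require Import all_classical.
From mathcomp Require Import topology.

Set Implicit Arguments.
Unset Strict Implicit.
Unset Printing Implicit Defensive.

Local Open Scope classical_set_scope.
Local Open Scope card_scope.

Section Theta.
Context {X : topologicalType}.
Implicit Types (M B A F U : set X) (x y : X).

(* The chain U_1, ..., U_n is given by a sequence indexed by nat; only the
   indices 1 <= i <= n matter. Meaningful for n >= 1. *)
Definition theta_separated (n : nat) (x : X) (M : set X) : Prop :=
  exists U : nat -> set X,
    [/\ forall i, 1 <= i <= n -> open_nbhs x (U i),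
        forall i, 1 <= i < n -> closure (U i) `<=` U i.+1
      & closure (U n) `&` M = set0].

Definition theta_closure (n : nat) (M : set X) : set X :=
  if n is 0 then closure M else [set x | ~ theta_separated n x M].

Definition theta_interior (n : nat) (M : set X) : set X :=
  ~` theta_closure n (~` M).

Definition S_cover (k : nat) (B : set X) (gamma : set (set X)) : Prop :=
  gamma `<=` open /\ B `<=` \bigcup_(U in gamma) theta_interior k U.

Definition card_lt (A B : set X) : Prop := (A #<= B) /\ ~ (B #<= A).

(* Meaningful for n >= 1. *)
Definition theta_converges (n : nat) (A B : set X) : Prop :=
  forall gamma : set (set X), S_cover n.-1 B gamma ->
    exists D : set (set X),
      [/\ finite_set D, D `<=` gamma
        & card_lt (A `\` \bigcup_(U in D) closure U) A].

(* Meaningful for infinite F. *)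
Definition complete_accumulation_point (F : set X) (x : X) : Prop :=
  forall U : set X, open_nbhs x U -> F `&` U #= F.

End Theta.

(* Meaningful for n >= 1. *)
Definition S_space (n : nat) (X : topologicalType) : Prop :=
  forall x y : X, x <> y -> ~ theta_closure n [set y] x.

Definition topological_embedding (X Y : topologicalType) (f : X -> Y) : Prop :=
  injective f /\
  forall A : set X, open A <-> exists2 B : set Y, open B & f @^-1` B = A.

(* A space containing X as a subspace is a space Y with an embedding of X
   into Y. *)
Definition S_closed (n : nat) (X : topologicalType) : Prop :=
  S_space n X /\
  forall (Y : topologicalType) (f : X -> Y),
    S_space n Y -> topological_embedding f -> closed (range f).

(* The topologies on the underlying type of X are the structures t; the
   equality and choice operators also packed in t are irrelevant. *)
Definition minimal_S (n : nat) (X : topologicalType) : Prop :=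
  S_space n X /\
  ~ exists t : Topological X,
      let X' : topologicalType := Topological.Pack t in
      S_space n X' /\ @open X' `<` @open X.

(* Main.v *)
(** Given a filter [F] and a point [p], let the new open sets be the open [V]
    with [p \in V -> V \in F]. If every [a <> p] has a chain [U_1, ..., U_n]
    with the complement of [cl U_n] in [F], the new topology is again S(n), so
    minimality forces every neighbourhood of [p] to belong to [F]. For [F] the
    trace of the neighbourhoods of a point of the closure of [X] in a larger
    space this contradicts S(n)-separation, whence [X] is S(n)-closed; for [F]
    generated by the sets [A \ cl U_1 \ ... \ cl U_k], [U_i] in a cover
    witnessing the failure of theta(n)-convergence, it makes [p] a complete
    accumulation point of [A].

    Conversely, given a coarser S(n) topology and an open [V] containing [x],
    the point [x] accumulates at no infinite subset of the complement of [V],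
    so all of these theta(n)-converge to [X \ {x}]. By induction on cardinality,
    finitely many closures of coarsely open sets not adherent to [x] cover the
    complement of [V], so [V] is a neighbourhood of [x] in the coarser topology. *)
Require Import Defs.
From HB Require Import structures.
From mathcomp Require Import all_boot all_order.
From mathcomp Require Import all_classical.
From mathcomp Require Import topology.

Local Open Scope classical_set_scope.

(** * Chains of neighbourhoods and symmetry of separation *)

Section ThetaChain.
Context {X : topologicalType}.
Implicit Types (n : nat) (x y : X) (M N : set X) (U W : nat -> set X).

Definition theta_chain n x U : Prop :=
  (forall i, 1 <= i <= n -> open_nbhs x (U i)) /\
  (forall i, 1 <= i < n -> closure (U i) `<=` U i.+1).

Lemma theta_separatedP n x M :
  theta_separated n x M <->
  exists2 U, theta_chain n x U & closure (U n) `&` M = set0.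
Proof. by split=> [[U [? ? ?]]|[U [? ?] ?]]; exists U. Qed.

Lemma theta_chain_le_last {n x U i} :
  theta_chain n x U -> 1 <= i <= n -> U i `<=` U n.
Proof.
move=> [_ cU] /andP[i1]; elim: n cU => [|n IHn] cU; first by case: i i1.
rewrite leq_eqVlt ltnS => /orP[/eqP-> //|lein].
have ltUn : closure (U n) `<=` U n.+1 by apply: cU; rewrite (leq_trans i1 lein) /=.
apply: subset_trans (IHn _ lein) (subset_trans (@subset_closure _ _) ltUn).
by move=> j /andP[j1 jn]; apply: cU; rewrite j1 ltnW.
Qed.

Lemma theta_chainI {n x U W} : theta_chain n x U -> theta_chain n x W ->
  theta_chain n x (fun i => U i `&` W i).
Proof.
move=> [oU cU] [oW cW]; split=> i lein.
  by apply: open_nbhsI; [exact: oU|exact: oW].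
by apply: subset_trans (@closureI _ _ _) _; apply: setISS; [exact: cU|exact: cW].
Qed.

(** The complements of the closures, in reverse order, form a chain at [y]: if [cl U_i] lies in the
    open set [U_{i+1}], the closure of the complement of [cl U_{i+1}] misses [U_{i+1}], hence
    [cl U_i]. *)
Lemma theta_separated_sym {n x y} : 1 <= n ->
  theta_separated n x [set y] -> theta_separated n y [set x].
Proof.
move=> n1 /theta_separatedP[U [oU cU] Uy].
have oU' i : 1 <= i <= n -> open (U i) by move=> /oU[].
have Uny : ~ closure (U n) y by move=> yU; rewrite -[False]/(set0 y) -Uy.
have le_cl i : 1 <= i <= n -> closure (U i) `<=` closure (U n).
  by move=> lein; apply: closureS; exact: (@theta_chain_le_last _ x U i (conj oU cU)).
have comp_cl (A : set X) : open A -> closure (~` closure A) `<=` ~` A.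
  move=> /open_closedC/closure_id clA; rewrite [X in _ `<=` X]clA.
  apply: closureS.
  by apply: subsetC; exact: subset_closure.
(* The last term is the complement of [closure (U 1)], whose closure misses [U 1] and so [x]. *)
apply/theta_separatedP; exists (fun i => ~` closure (U (n.+1 - i))).
  split=> i /andP[i1 lein].
    have rng : 1 <= n.+1 - i <= n.
      by rewrite subn_gt0 ltnS lein leq_subLR -add1n leq_add2r.
    split; first by apply: closed_openC; exact: closed_closure.
    by move=> /(le_cl _ rng).
  have -> : n.+1 - i = (n.+1 - i.+1).+1 by rewrite subSS subSn // ltnW.
  have rng : 1 <= n.+1 - i.+1 < n.
    by rewrite subSS subn_gt0 lein /= -{2}(subn0 n) ltn_sub2l.
  apply: subset_trans (comp_cl _ _) _.
    by apply: oU'; have /andP[_ ->] := rng.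
  by apply: subsetC; exact: cU.
rewrite subSnn; apply/seteqP; split=> // z [+ zx]; rewrite {}zx.
by move=> /(comp_cl _ (oU' 1 _)); rewrite n1 => /(_ isT); apply; case: (oU 1); rewrite ?n1.
Qed.

End ThetaChain.

Lemma S_spaceP n (X : topologicalType) : 1 <= n ->
  S_space n X <-> forall x y : X, x <> y ->
    exists2 U, theta_chain n x U & ~ closure (U n) y.
Proof.
case: n => // n _; split=> [SX x y /SX /contrapT/theta_separatedP[U cU Uy]|SX x y].
  by exists U => // yU; rewrite -[False]/(set0 y) -Uy.
move=> /SX[U cU Uy]; apply; apply/theta_separatedP; exists U => //.
by apply/seteqP; split=> // z [+ zy]; rewrite zy.
Qed.

(** * Weakening the topology at one point *)

(* [X] with the neighbourhoods of the single point [p] weakened: an open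
   neighbourhood of [p] must in addition belong to the filter [F]. *)
Definition weakened_at (X : topologicalType) (p : X) (F : set_system X)
  & Filter F : Type := X.

Section WeakenedAt.
Context {X : topologicalType} {p : X} {F : set_system X} {FF : Filter F}.

Let weak_open (V : set X) := open V /\ (V p -> F V).

Let weak_openT : weak_open setT.
Proof. by split=> [|_]; [exact: openT|exact: filterT]. Qed.

Let weak_openI : setI_closed weak_open.
Proof.
move=> A B [oA FA] [oB FB]; split=> [|[Ap Bp]]; first exact: openI.
by apply: filterI; [exact: FA|exact: FB].
Qed.

Let weak_open_bigU (I : Type) (f : I -> set X) :
  (forall i, weak_open (f i)) -> weak_open (\bigcup_i f i).
Proof.
move=> of_; split=> [|[i _ fip]].
  by apply: bigcup_open => i _; have [] := of_ i.
apply: (@filterS _ F _ (f i)); first by move=> z fiz; exists i.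
by have [_] := of_ i; apply.
Qed.

HB.instance Definition _ := Choice.copy (weakened_at X p F FF) X.
HB.instance Definition _ := isOpenTopological.Build (weakened_at X p F FF)
  weak_openT weak_openI weak_open_bigU.

End WeakenedAt.

Lemma minimal_S_filter {n} {X : topologicalType} {p : X} {F : set_system X}
    (FF : Filter F) : 1 <= n -> minimal_S n X ->
  (forall a, a <> p -> exists2 U, theta_chain n a U & F (~` closure (U n))) ->
  forall V, open_nbhs p V -> F V.
Proof.
move=> n1 [SX minX] sepF V [oV Vp]; apply: contrapT => nFV; apply: minX.
pose X' : topologicalType := weakened_at X p F FF.
exists (Topological.class X'); split; last first.
  by split=> [W []//|/(_ _ oV)[_ /(_ Vp)]].
have {}SX := (S_spaceP n X n1).1 SX.
have sep a b : a <> p -> a <> b ->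
    exists2 U, @theta_chain X' n a U & ~ @closure X' (U n) b.
  move=> ap ab.
  have [U1 cU1 FU1] := sepF a ap.
  have [U2 cU2 U2p] := SX a p ap.
  have [U3 cU3 U3b] := SX a b ab.
  (* The factors serve in turn to put the complement of the closure in [F], to keep [p] out of it,
     and to keep [b] out. *)
  pose U i := U1 i `&` (U2 i `&` U3 i).
  have cU : @theta_chain X n a U by do 2?apply: theta_chainI.
  have nUp : ~ @closure X (U n) p.
    by move/(@closureI X); case=> _ /(@closureI X)[].
  have FU : F (~` @closure X (U n)).
    by apply: filterS FU1; apply: subsetC => z /(@closureI X)[].
  have nUb : ~ @closure X (U n) b.
    by move/(@closureI X); case=> _ /(@closureI X)[].
  (* [closure (U i)] taken in [X] stays closed in [X'], since its complement lies in [F]; so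
     closures along the chain do not grow. *)
  have clE i : 1 <= i <= n -> @closure X' (U i) `<=` @closure X (U i).
    move=> lein z; rewrite (@closureE X') => /(_ (@closure X (U i))); apply.
    split; last exact: (@subset_closure X).
    rewrite -(@openC X'); split=> [|_].
      by apply: (@closed_openC X); exact: closed_closure.
    apply: filterS FU; apply: subsetC; apply: closureS.
    exact: (theta_chain_le_last cU lein).
  exists U; last by move=> /clE; rewrite n1 leqnn => /(_ isT).
  split=> i lein.
    have [oUi Ua] := cU.1 i lein; split=> //; split=> // Up.
    by case: nUp; apply: (@subset_closure X); exact: (theta_chain_le_last cU lein).
  apply: subset_trans (cU.2 i lein); apply: clE.
  by case/andP: lein => -> /ltnW.
apply/(S_spaceP n _ n1) => a b ab.
have [ap|ap] := pselect (a = p); last exact: sep.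
(* A chain at [p] itself is obtained by separating [b] from [p] and using symmetry. *)
have [||U cU Ua] := sep b a; [by rewrite -ap => ba; apply: ab|exact: nesym|].
have : @theta_separated X' n b [set a].
  by apply/theta_separatedP; exists U => //; apply/seteqP; split=> // z [+ za]; rewrite za.
move=> /(theta_separated_sym n1)/theta_separatedP[W cW Wb].
by exists W => // bW; rewrite -[False]/(@set0 X' b) -Wb.
Qed.

(** * Minimality implies closedness *)

Lemma minimal_S_closed n (X : topologicalType) :
  1 <= n -> minimal_S n X -> S_closed n X.
Proof.
move=> n1 mX; split=> [|Y f SY [finj fE] y yf]; first exact: mX.1.
apply: contrapT => nyf; have {}SY := (S_spaceP n Y n1).1 SY.
have opf W : open W -> open (f @^-1` W) by move=> oW; apply/fE; exists W.
have clf M : closure (f @^-1` M) `<=` f @^-1` (closure M).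
  move=> x clx B; rewrite nbhsE => -[B' [oB' B'fx] B'B].
  have [|z [Mz B'z]] := clx (f @^-1` B').
    by apply: open_nbhs_nbhs; split=> //; exact: opf.
  by exists (f z); split=> //; exact: B'B.
have fp (x : X) : f x <> y by move=> fxy; apply: nyf; exists x.
have [|_ [[p _ _] _]] := yf setT; first exact: filterT.
have [W [oW cW] Wp] := SY y (f p) (nesym (fp p)).
pose F := filter_from (open_nbhs y) (fun W => f @^-1` W).
have FF : Filter F.
  apply: filter_from_filter => [|V1 V2 V1y V2y]; first by exists setT; exact: open_nbhsT.
  by exists (V1 `&` V2) => //; exact: open_nbhsI.
have oclC (M : set Y) : open (~` closure M).
  by apply: closed_openC; exact: closed_closure.
(* This preimage is a neighbourhood of [p], so it contains the trace of a neighbourhood [V] of [y];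
   but [V] and [W n] must meet inside the range of [f]. *)
have [||V oV VW] := minimal_S_filter (p := p) FF n1 mX _ (f @^-1` (~` closure (W n))).
- move=> a _; have [U [oU cU] Uy] := SY (f a) y (fp a).
  exists (fun i => f @^-1` (U i)); last first.
    exists (~` closure (U n)); first by split => //; exact: oclC.
    apply: subsetC; exact: clf.
  split=> i lein; first by have [oUi Uia] := oU i lein; split => //; exact: opf.
  apply: subset_trans (clf _) _; apply: preimage_subset; exact: cU.
- by split=> //; apply: opf; exact: oclC.
have [z [[x _ xz] [Vz Wz]]] : range f `&` (V `&` W n) !=set0.
  apply: yf; apply: filterI; apply: open_nbhs_nbhs => //.
  by apply: oW; rewrite n1 leqnn.
by rewrite -{}xz in Vz Wz; apply: (VW x Vz); exact: subset_closure.
Qed.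

(** * Theta-interiors and ends of chains *)

Lemma theta_interior_subset {X : topologicalType} (k : nat) (M : set X) :
  theta_interior k M `<=` M.
Proof.
case: k => [|k] x /=.
  by apply: contra_notP => nMx; exact: subset_closure.
move=> /contrapT/theta_separatedP[U [oU _] UM]; apply: contrapT => nMx.
rewrite -[False]/(set0 x) -UM; split=> //; apply: subset_closure.
by have [|_] := oU k.+1; first exact: leqnn.
Qed.

(** For [n >= 2], [M] is appended to a chain of length [n.-1] whose last closure lies in [M].
    Members of an S(n-1)-cover thus end chains of length [n]. *)
Lemma theta_interior_chain {X : topologicalType} {n : nat} {x : X} {M : set X} :
  1 <= n -> open M -> theta_interior n.-1 M x ->
  exists2 U, theta_chain n x U & U n = M.
Proof.
case: n => [//|[|n]] _ oM /[dup] /theta_interior_subset Mx.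
  by move=> _; exists (fun=> M) => //; split=> [i _|[|[|]]//]; split.
move=> /contrapT/theta_separatedP[U [oU cU] UM].
exists (fun i => if i == n.+2 then M else U i); last by rewrite eqxx.
split=> i /andP[i1]; rewrite ?ltnS leq_eqVlt => /orP[/eqP->|].
- by rewrite eqxx; split.
- by move=> lti; rewrite ltn_eqF //; apply: oU; rewrite i1.
- rewrite eqxx ltn_eqF // => z zU; apply: contrapT => nMz.
  by rewrite -[False]/(set0 z) -UM.
- move=> lti; rewrite !ltn_eqF //; last exact: ltnW.
  by apply: cU; rewrite i1.
Qed.

Lemma theta_chain_interior {X : topologicalType} {n : nat} {x : X}
    {U : nat -> set X} :
  1 <= n -> theta_chain n x U -> theta_interior n.-1 (U n) x.
Proof.
case: n => [//|[|n]] _ [oU cU] /=.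
  rewrite -[theta_interior _ _]/(~` closure (~` U 1)) closure_setC setCK.
  by apply: open_nbhs_nbhs; exact: oU.
apply; exists U; split=> [i /andP[i1 lein]|i /andP[i1 lein]|].
- by apply: oU; rewrite i1 leqW.
- by apply: cU; rewrite i1 leqW.
- by apply/disjoints_subset; rewrite setCK; apply: cU; rewrite ltnSn.
Qed.

(* A maximal family of choice functions on [C] that pairwise differ at every
   member of [C] must exhaust some member of [C]; it injects into the others. *)
Lemma ex_card_minimal {T : Type} {C : set (set T)} : C !=set0 ->
  exists2 A, C A & forall B, C B -> (A #<= B)%card.
Proof.
move=> [A0 CA0]; have [[A [CA A_0]]|C0] := pselect (exists A, C A /\ A = set0).
  by exists A => // B _; rewrite A_0; exact: card_ge0.
pose P (G : set (set T -> T)) :=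
  (forall g B, G g -> C B -> B (g B)) /\
  (forall g h B, G g -> G h -> C B -> g B = h B -> g = h).
have [|G [[GC Ginj] maxG]] := @Zorn_bigcup _ P.
  move=> F FP totF; split=> [g B [G FG Gg] CB|g h B [G FG Gg] [H FH Hh] CB gh].
    exact: (FP G FG).1 g B Gg CB.
  by have [GH|HG] := totF G H FG FH;
    [apply: ((FP H FH).2 g h B) => //; exact: GH
    |apply: ((FP G FG).2 g h B) => //; exact: HG].
have [[A CA GA]|nG] := pselect (exists2 A, C A & A `<=` [set g A | g in G]).
  exists A => // B CB; apply: card_le_trans (subset_card_le GA) _.
  apply: card_le_trans (card_image_le _ _) _.
  have injB : {in G &, injective (fun g : set T -> T => g B)}.
    by move=> g h /set_mem Gg /set_mem Gh /(Ginj g h B Gg Gh CB).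
  have GB : [set g B | g in G] `<=` B by move=> _ [g Gg <-]; exact: GC Gg CB.
  apply: card_le_trans (subset_card_le GB).
  by have := inj_card_eq injB; rewrite card_eq_le => /andP[].
have [t _] : A0 !=set0.
  by apply/set0P/eqP => A00; apply: C0; exists A0.
(* If [G] exhausts no member of [C], the values it misses yield a choice function [h] that enlarges
   [G]. *)
have /choice[h hP] (B : set T) :
    exists y, C B -> B y /\ ~ [set g B | g in G] y.
  have [CB|nCB] := pselect (C B); last by exists t.
  apply: contrapT => nB; apply: nG; exists B => // y By.
  by apply: contrapT => nGy; apply: nB; exists y.
have nGh : ~ G h by move=> Gh; apply: (hP A0 CA0).2; exists h.
exfalso; apply: (maxG (G `|` [set h])).
  by split; [exact: subsetUl|move=> /(_ h (or_intror erefl))].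
split=> [g B [Gg|->] CB|g g' B]; [exact: GC Gg CB|exact: (hP B CB).1|].
move=> [Gg|->] [Gg'|->] CB //; first exact: Ginj Gg Gg' CB.
  by move=> gh; case: (hP B CB).2; exists g.
by move=> hg; case: (hP B CB).2; exists g'.
Qed.

(** The induction takes a counterexample [M] of least cardinality: convergence leaves a strictly
    smaller remainder, finitely covered by minimality, so [M] is covered too. *)
Lemma theta_converges_finite_subcover {n : nat} {X : topologicalType}
    {A B : set X} {gamma : set (set X)} :
  S_cover n.-1 B gamma -> A `<=` B ->
  (forall A', A' `<=` A -> infinite_set A' -> theta_converges n A' B) ->
  exists D, [/\ finite_set D, D `<=` gamma & A `<=` \bigcup_(U in D) closure U].
Proof.
move=> covB AB convA; apply: contrapT => nA.
pose covered (A' : set X) := exists D,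
  [/\ finite_set D, D `<=` gamma & A' `<=` \bigcup_(U in D) closure U].
have [|M [MA nM] minM] := @ex_card_minimal X [set A' | A' `<=` A /\ ~ covered A'].
  by exists A; split.
have infM : infinite_set M.
  move=> finM; apply: nM.
  have /choice[f fP] y : exists U, M y -> gamma U /\ U y.
    have [My|] := pselect (M y); last by exists set0.
    have [U gU Uy] := covB.2 y (AB y (MA y My)).
    by exists U => _; split=> //; exact: theta_interior_subset Uy.
  exists (f @` M); split; first exact: finite_image.
    by move=> _ [y My <-]; exact: (fP y My).1.
  move=> y My; exists (f y); first by exists y.
  by apply: subset_closure; exact: (fP y My).2.
have [D [finD Dg [_ ltM]]] := convA M MA infM gamma covB.
apply: ltM; apply: minM; split; first exact: subset_trans (@subDsetl _ _ _) MA.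
move=> [D' [finD' D'g MD']]; apply: nM; exists (D `|` D'); split.
- by rewrite finite_setU.
- by rewrite subUset.
- rewrite bigcup_setU => y My; apply: contrapT => /not_orP[nD nD'].
  by apply: nD'; apply: MD'.
Qed.

(** * The accumulation criterion *)

Lemma minimal_S_accumulation n (X : topologicalType) (A : set X) (x : X) :
  1 <= n -> minimal_S n X -> ~ theta_converges n A (~` [set x]) ->
  complete_accumulation_point A x.
Proof.
move=> n1 mX; apply: contra_notP => /existsNP[V /not_implyP[Vx nAV]].
move=> gamma [ogamma covx]; apply: contrapT => nconv.
pose fin (D : set (set X)) := finite_set D /\ D `<=` gamma.
pose F := filter_from fin (fun D => A `\` \bigcup_(U in D) closure U).
have FF : Filter F.
  apply: filter_from_filter => [|D D' [finD Dg] [finD' D'g]].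
    by exists set0; split; [exact: finite_set0|exact: sub0set].
  exists (D `|` D'); first by split; [rewrite finite_setU|rewrite subUset].
  by rewrite bigcup_setU setDUr.
have [a /(covx a)[U gU Ua]|D [finD Dg] DV] :=
    minimal_S_filter (p := x) FF n1 mX _ V Vx.
  have [W cW WU] := theta_interior_chain n1 (ogamma _ gU) Ua.
  exists W => //; exists [set U]; first by split; [exact: finite_set1|move=> _ ->].
  by rewrite bigcup_set1 WU => y [].
apply: nconv; exists D; split=> //; split; first exact: card_le_setD.
(* A remainder as large as [A] would lie in both [A] and [V], against the choice of [V]. *)
move=> leA; apply: nAV; apply/card_eqPle; split; first exact: subset_card_le.
apply: card_le_trans leA _; apply: subset_card_le => y ADy.
by split; [exact: ADy.1|exact: DV].
Qed.

Lemma accumulation_minimal_S n (X : topologicalType) :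
  1 <= n -> S_space n X ->
  (forall (A : set X) (x : X), infinite_set A ->
     ~ theta_converges n A (~` [set x]) -> complete_accumulation_point A x) ->
  minimal_S n X.
Proof.
move=> n1 SX accX; split=> // -[t]; set X' := Topological.Pack t => -[SX' [oX'X]].
apply=> V oV.
have {}SX' := (S_spaceP n X' n1).1 SX'.
have clX' (M : set X) : @closure X M `<=` @closure X' M.
  move=> z; rewrite (@closureE X) => /(_ (@closure X' M)); apply.
  split; last exact: (@subset_closure X').
  rewrite -(@openC X); apply: oX'X; apply: (@closed_openC X').
  exact: closed_closure.
rewrite (@openE X') => x Vx.
(* Chains of [X'] remain chains in [X], where closures are smaller, so S(n)-separation from [x] in
   [X'] makes [gamma] a cover. *)
pose gamma := [set U : set X | @open X' U /\ ~ @closure X' U x].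
have covx : @S_cover X n.-1 (~` [set x]) gamma.
  split=> [U []/oX'X//|y /(SX' y x)[U [oU cU] Ux]].
  have oUn : @open_nbhs X' y (U n) by apply: oU; rewrite n1 leqnn.
  exists (U n); first by split=> //; case: oUn.
  apply: theta_chain_interior => //; split=> i lein.
    by have [/oX'X oUi Uiy] := oU i lein; split.
  by apply: subset_trans (cU i lein); exact: clX'.
have [||D [finD Dg VD]] :=
    @theta_converges_finite_subcover n X (~` V) _ gamma covx.
- by apply: subsetC => _ ->.
- move=> A' A'V infA'; apply: contrapT => /(accX _ _ infA')/(_ V (conj oV Vx)).
  have -> : A' `&` V = set0 by apply/disjoints_subset.
  rewrite card_eq_sym card_eq0 => /eqP A'0; apply: infA'; rewrite A'0.
  exact: finite_set0.
(* Coarse closures contain those of [X], and a finite union of them is coarsely closed; its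
   complement is the required neighbourhood of [x] inside [V]. *)
pose K := \bigcup_(U in D) @closure X' U.
have oK : @open X' (~` K).
  apply: (@closed_openC X'); apply: (@closed_bigcup X') => // U _.
  exact: closed_closure.
apply: (@filterS _ (@nbhs X' X' x) _ (~` K)).
  move=> y nKy; apply: contrapT => /VD[U DU Uy]; apply: nKy.
  by exists U => //; exact: clX'.
by apply: (@open_nbhs_nbhs X'); split=> // -[U /Dg[_]].
Qed.

Theorem theorem5p3 (n : nat) (X : topologicalType) (hn : 1 <= n)
    (hX : S_space n X) :
  minimal_S n X <->
  (S_closed n X /\
   forall (A : set X) (x : X), infinite_set A ->
     ~ theta_converges n A (~` [set x]) -> complete_accumulation_point A x).
Proof.
split=> [mX|[_ accX]]; last exact: accumulation_minimal_S.
split; first exact: minimal_S_closed.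
by move=> A x _; exact: minimal_S_accumulation.
Qed.
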